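(* Let $(X,Y,A,f,h)$ satisfy the standing assumptions in the context. Let $\alpha_k\in[0,1]$, $k=0,1,2,\dots$, and let $(x_k,u_k,s_k,z_k)$, $k=0,1,2,\dots$, be the iterates generated by the primal-dual hybrid algorithm for $\min_{x\in X}\{f(Ax)+h(x)\}$ (defined in the context) with step sizes $\alpha_k$. If $\alpha_0=1$, then for all $k=1,2,\dots$ $$f(Ax_k)+h(x_k)+f^*(u_k)+h^*(-A^*u_k)=\sum_{i=0}^{k-1}\mu_i^k\bigl(\mathcal{D}_{f\circ A,h}(x_i,s_i,\alpha_i)+\mathcal{D}_{h^*\circ A^*,\tilde f^*}(-u_i,-z_i,\alpha_i)\bigr).$$
   Context: Setting. $X,Y$ are finite-dimensional real vector spaces with duals $X^*,Y^*$ and pairings $\langle\cdot,\cdot\rangle$; $A:X\to Y$ is linear with adjoint $A^*:Y^*\to X^*$; $f:Y\to\mathbb{R}\cup\{\infty\}$ and $h:X\to\mathbb{R}\cup\{\infty\}$ are proper closed convex functions with Fenchel conjugates $f^*:Y^*\to\mathbb{R}\cup\{\infty\}$, $h^*:X^*\to\mathbb{R}\cup\{\infty\}$. $\operatorname{dom}(\partial f)\subseteq Y$ and $\operatorname{dom}(\partial h^* )\subseteq X^*$ are the sets of points at which the respective subdifferential is nonempty. Single-valued oracles are fixed: for each $y\in\operatorname{dom}(\partial f)$, $\partial f(y)\in Y^*$ denotes one fixed chosen element of $\operatorname{argmax}_{v\in Y^*}\{\langle v,y\rangle-f^*(v)\}$ (the subdifferential of $f$ at $y$); for each $u\in\operatorname{dom}(\partial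 h^* )$, $\partial h^*(u)\in X$ denotes one fixed chosen element of $\operatorname{argmax}_{x\in X}\{\langle u,x\rangle-h(x)\}$ (the subdifferential of $h^*$ at $u$). Standing assumption: $-A^*\partial f(y)\in\operatorname{dom}(\partial h^* )$ for all $y\in\operatorname{dom}(\partial f)$, and $A\,\partial h^*(u)\in\operatorname{dom}(\partial f)$ for all $u\in\operatorname{dom}(\partial h^* )$. Generalized Bregman distances: $D_f(y,w)=f(y)-f(w)-\langle\partial f(w),y-w\rangle$ for $w\in\operatorname{dom}(\partial f)$, $y\in\operatorname{dom}(f)$, and $D_{h^*}(v,u)=h^*(v)-h^*(u)-\langle v-u,\partial h^*(u)\rangle$ for $u\in\operatorname{dom}(\partial h^* )$, $v\in\operatorname{dom}(h^* )$, with the chosen subgradients; $D_{f\circ A}(x',x):=D_f(Ax',Ax)$ and $D_{h^*\circ A^*}(v',v):=D_{h^*}(A^*v',A^*v)$. Notation: $\tilde f(y):=f(-y)$ (so $\tilde f^*(v)=f^*(-v)$), $$\mathcal{D}_{f\circ A,h}(x,s,\alpha):=D_{f\circ A}((1-\alpha)x+\alpha s,x)+h((1-\alpha)x+\alpha s)-(1-\alpha)h(x)-\alpha h(s),$$ $$\mathcal{D}_{h^*\circ A^*,\tilde f^*}(v,-z,\alpha):=D_{h^*\circ A^*}((1-\alpha)v-\alpha z,v)+f^*(-(1-\alpha)v+\alpha z)-(1-\alpha)f^*(-v)-\alpha f^*(z),$$ with the convention $0\cdot\infty=0$ (relevant only for $i=0$, $\alpha_0=1$). Primal-dual hybrid algorithm: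 given $x_0\in X$ with $Ax_0\in\operatorname{dom}(\partial f)$ and $u_0\in Y^*$ with $-A^*u_0\in\operatorname{dom}(\partial h^* )$, for $k=0,1,2,\dots$: $(s_k,z_k):=(\partial h^*(-A^*u_k),\partial f(Ax_k))$, $(x_{k+1},u_{k+1}):=(1-\alpha_k)(x_k,u_k)+\alpha_k(s_k,z_k)$, where $\alpha_k\in[0,1]$. The iterates are understood to be well defined, i.e. $Ax_k\in\operatorname{dom}(\partial f)$ and $-A^*u_k\in\operatorname{dom}(\partial h^* )$ for all $k$. Weights: for $k=0,1,2,\dots$, $\mu^{k+1}_k=1$ and $\mu^{k+1}_i=(1-\alpha_k)\mu^k_i$ for $i=0,\dots,k-1$. *)

(* Defs.v *)
(* MathComp / MathComp-Analysis *)
From HB Require Import structures.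
From mathcomp Require Import all_boot all_order all_algebra.
From mathcomp Require Import all_classical all_reals.
From mathcomp Require Import ereal topology normedtype.

Set Implicit Arguments.
Unset Strict Implicit.
Unset Printing Implicit Defensive.

Import Order.TTheory GRing.Theory Num.Theory.
Import numFieldNormedType.Exports.

Local Open Scope classical_set_scope.
Local Open Scope ring_scope.
Local Open Scope ereal_scope.

(* The dual of a finite-dimensional real space V (V : vectType R) is
   'Hom(V, R^o).  Functions with values in R U {+oo} are functions to \bar R
   that are never -oo, which is part of [proper_efun]. *)

Section ConvexFunctions.
Variables (R : realType) (V : vectType R).
Implicit Types (f : V -> \bar R) (y : V) (v : 'Hom(V, R^o)).

Definition pairing v y : R := v y.

Definition proper_efun f := (forall y, f y != -oo) /\ (exists y, f y < +oo).

Definition convex_efun f := forall (y y' : V) (t : R), (0 <= t <= 1)%R ->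
  f ((1 - t) *: y + t *: y')%R <= (1 - t)%:E * f y + t%:E * f y'.

(* A vectType carries no topology: the topology of V is the usual one of R^n
   transported by the linear coordinate isomorphism r2v : 'rV_n -> V.  All
   linear isomorphisms with R^n give the same topology.  For functions that are
   never -oo, closedness is lower semicontinuity. *)
Definition closed_efun f :=
  lower_semicontinuous (fun r : 'rV[R]_(dim V) => f (VectorInternalTheory.r2v r)).

Definition conjugate f v : \bar R :=
  ereal_sup (range (fun y => (pairing v y)%:E - f y)).

Definition argmax (T : Type) (phi : T -> \bar R) : set T :=
  [set t | forall t', phi t' <= phi t].

Definition subdiff f y : set 'Hom(V, R^o) :=
  argmax (fun v => (pairing v y)%:E - conjugate f v).

(* The subdifferential of the conjugate f^* at v, as a subset of V rather than
   of the bidual. *)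
Definition subdiff_conjugate f v : set V :=
  argmax (fun y => (pairing v y)%:E - f y).

Definition dom_subdiff f : set V := [set y | subdiff f y !=set0].

Definition dom_subdiff_conjugate f : set 'Hom(V, R^o) :=
  [set v | subdiff_conjugate f v !=set0].

Definition reflect_fun f : V -> \bar R := fun y => f (- y)%R.

(* Bregman distances with respect to a fixed selection of subgradients: df is a
   selection of [subdiff f], and dfs one of [subdiff_conjugate f].  The values
   are meaningful when the second argument is in the domain of the selection. *)
Definition bregman f (df : V -> 'Hom(V, R^o)) (y w : V) : \bar R :=
  f y - f w - (pairing (df w) (y - w))%:E.

Definition bregman_conjugate f (dfs : 'Hom(V, R^o) -> V)
    (v u : 'Hom(V, R^o)) : \bar R :=
  conjugate f v - conjugate f u - (pairing (v - u) (dfs u))%:E.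

End ConvexFunctions.

Section Composition.
Variables (R : realType) (X Y : vectType R) (A : 'Hom(X, Y)).

Definition adjoint (u : 'Hom(Y, R^o)) : 'Hom(X, R^o) := (u \o A)%VF.

Definition bregman_comp (f : Y -> \bar R) (df : Y -> 'Hom(Y, R^o))
    (x' x : X) : \bar R :=
  bregman f df (A x') (A x).

Definition bregman_conjugate_comp (h : X -> \bar R) (dhs : 'Hom(X, R^o) -> X)
    (v' v : 'Hom(Y, R^o)) : \bar R :=
  bregman_conjugate h dhs (adjoint v') (adjoint v).

(* df and dhs are total functions; only their values at A x_k and -A^* u_k
   are used. *)
Definition primal_dual_hybrid (df : Y -> 'Hom(Y, R^o))
    (dhs : 'Hom(X, R^o) -> X) (alpha : nat -> R)
    (x s : nat -> X) (u z : nat -> 'Hom(Y, R^o)) : Prop :=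
  forall k, [/\ s k = dhs (- adjoint (u k))%R,
                z k = df (A (x k)),
                x k.+1 = ((1 - alpha k) *: x k + alpha k *: s k)%R
              & u k.+1 = ((1 - alpha k) *: u k + alpha k *: z k)%R].

End Composition.

(* calD D g x s a is the quantity \mathcal{D}_{F,g}(x, s, a), where D is the
   Bregman distance of F.  In \bar R, 0 * +oo = 0. *)
Definition calD (R : realType) (V : vectType R) (D : V -> V -> \bar R)
    (g : V -> \bar R) (x s : V) (a : R) : \bar R :=
  D ((1 - a) *: x + a *: s)%R x + g ((1 - a) *: x + a *: s)%R
  - (1 - a)%:E * g x - a%:E * g s.

(* weight alpha k i is \mu^k_i; it is 0 for i >= k, where \mu^k_i is not used. *)
Fixpoint weight (R : realType) (alpha : nat -> R) (k i : nat) : R :=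
  if k is k'.+1 then
    if i == k' then 1%R else ((1 - alpha k') * weight alpha k' i)%R
  else 0%R.

Lemma conjugate_reflect (R : realType) (V : vectType R) (f : V -> \bar R) v :
  conjugate (reflect_fun f) v = conjugate f (- v)%R.
Proof.
have pN y : pairing (- v)%R (- y)%R = pairing v y.
  by rewrite /pairing opp_lfunE linearN opprK.
rewrite /conjugate /reflect_fun; congr ereal_sup.
apply/seteqP; split=> _ [y _ <-]; exists (- y)%R => //; first by rewrite pN.
by rewrite -pN !opprK.
Qed.

Lemma calD_conjugateE (R : realType) (X Y : vectType R) (A : 'Hom(X, Y))
    (f : Y -> \bar R) (h : X -> \bar R) (dhs : 'Hom(X, R^o) -> X)
    (v z : 'Hom(Y, R^o)) (a : R) :
  let D := bregman_conjugate_comp A h dhs in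
  calD D (conjugate (reflect_fun f)) v (- z)%R a =
  D ((1 - a) *: v - a *: z)%R v
  + conjugate f (- ((1 - a) *: v) + a *: z)%R
  - (1 - a)%:E * conjugate f (- v)%R - a%:E * conjugate f z.
Proof. by rewrite /calD !conjugate_reflect scalerN opprD !opprK. Qed.

(* Main.v *)
Require Import Defs.
From HB Require Import structures.
From mathcomp Require Import all_boot all_order all_algebra.
From mathcomp Require Import all_classical all_reals.
From mathcomp Require Import ereal topology normedtype derive.
From mathcomp Require Import ring lra.

Set Implicit Arguments.
Unset Strict Implicit.
Unset Printing Implicit Defensive.

Import Order.TTheory GRing.Theory Num.Theory.
Import numFieldNormedType.Exports.

Local Open Scope classical_set_scope.
Local Open Scope ring_scope.
Local Open Scope ereal_scope.

(* Write a = alpha_k and let gap_k be the left-hand side. The Bregman terms of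
   step k add up to gap_(k+1) - (1 - a) gap_k, up to -a times
   f(A x_k) + f^*(z_k) - <z_k, A x_k> and h^*(-A^* u_k) + h(s_k) + <u_k, A s_k>,
   and both vanish by the Fenchel-Young equality. As 1 - alpha_0 = 0, unrolling
   gap_(k+1) = (1 - a) gap_k + incr_k produces the weights. Since subgradients
   are defined as maximizers of <v, y> - f^*(v), the first equality needs
   f = f^**, obtained by projecting points onto the epigraph. *)

(** * Euclidean projection onto closed convex sets of row vectors *)

Section Projection.
Variables (R : realType) (n : nat).
Implicit Types (a b c w p : 'rV[R]_n) (C : set 'rV[R]_n).

Definition dotp a b : R := (a *m b^T)%R 0%R 0%R.

Lemma dotpE a b : dotp a b = (\sum_i a 0 i * b 0 i)%R.
Proof. by rewrite /dotp mxE; apply: eq_bigr => i _; rewrite mxE. Qed.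

Lemma dotpC a b : dotp a b = dotp b a.
Proof. by rewrite !dotpE; apply: eq_bigr => i _; rewrite mulrC. Qed.

Lemma dotpDl a b c : dotp (a + b)%R c = (dotp a c + dotp b c)%R.
Proof. by rewrite /dotp mulmxDl mxE. Qed.

Lemma dotpZl t a b : dotp (t *: a)%R b = (t * dotp a b)%R.
Proof. by rewrite /dotp -scalemxAl mxE. Qed.

Lemma dotpNl a b : dotp (- a)%R b = (- dotp a b)%R.
Proof. by rewrite -scaleN1r dotpZl mulN1r. Qed.

Lemma dotpDr a b c : dotp a (b + c)%R = (dotp a b + dotp a c)%R.
Proof. by rewrite dotpC dotpDl !(dotpC a). Qed.

Lemma dotpZr t a b : dotp a (t *: b)%R = (t * dotp a b)%R.
Proof. by rewrite dotpC dotpZl dotpC. Qed.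

Lemma dotpNr a b : dotp a (- b)%R = (- dotp a b)%R.
Proof. by rewrite dotpC dotpNl dotpC. Qed.

Lemma dotp_coord_le a i : (a 0 i ^+ 2 <= dotp a a)%R.
Proof.
rewrite dotpE (bigD1 i) //= -expr2 lerDl sumr_ge0 // => j _.
by rewrite -expr2 sqr_ge0.
Qed.

Lemma dotp_ge0 a : (0 <= dotp a a)%R.
Proof. by rewrite dotpE sumr_ge0 // => j _; rewrite -expr2 sqr_ge0. Qed.

Lemma dotp_eq0 a : dotp a a = 0%R -> a = 0%R.
Proof.
move=> a0; apply/rowP => i; apply/eqP; rewrite mxE -sqrf_eq0 eq_le sqr_ge0.
by rewrite -a0 dotp_coord_le.
Qed.

Lemma continuous_dist2 w : continuous (fun c => dotp (c - w)%R (c - w)%R).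
Proof.
under eq_fun do rewrite dotpE.
apply: continuous_big => [|i _]; first exact: add_continuous.
have cc : continuous (fun c => (c - w)%R 0%R i).
  have -> : (fun c => (c - w) 0 i)%R = (fun c => c 0 i - w 0 i)%R.
    by apply/funext => c; rewrite !mxE.
  by move=> c; apply: (@continuousB _ _ _ (fun c : 'rV[R]_n => c 0%R i)
    (cst (w 0%R i))); [exact: coord_continuous|exact: cst_continuous].
by move=> c; apply: continuousM; exact: cc.
Qed.

(** Cutting [C] by the ball around [w] through one of its points gives a compact set, where the
    extreme value theorem yields a minimizer; points outside the ball are farther away anyway. *)
Lemma projection_exists C w : closed C -> C !=set0 ->
  exists2 p, C p &
    forall c, C c -> (dotp (p - w) (p - w) <= dotp (c - w) (c - w))%R.
Proof.
move=> Ccl [c0 Cc0]; pose d c := dotp (c - w)%R (c - w)%R.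
pose K := C `&` [set c | (d c <= d c0)%R].
have Kc : compact K.
  apply: bounded_closed_compact; last first.
    apply: closedI => //.
    apply: (@preimage_closed _ _ d [set r | (r <= d c0)%R]).
      by move=> ? _; exact: continuous_dist2.
    exact: (@closed_le R (d c0)).
  (* The norm is the sup norm. Each coordinate of [c - w] has square at most [d c0], hence absolute
     value at most [1 + d c0]. *)
  exists (1 + d c0 + `|w|)%R; split; first exact: num_real.
  move=> M ltM c [_ /= dc].
  have d0 : (0 <= d c0)%R by exact: dotp_ge0.
  apply: le_trans (ltW ltM); rewrite -(subrK w c).
  apply: le_trans (ler_normD _ _) _; rewrite lerD2r.
  rewrite /Num.norm /= mx_normrE; apply: bigmax_le => [|[i j] _]; first by lra.
  rewrite ord1 /=.
  have := le_trans (dotp_coord_le (c - w)%R j) dc.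
  rewrite -real_normK ?num_real //.
  have := normr_ge0 ((c - w) 0 j)%R.
  by move=> /= ? ?; nra.
have K0 : K !=set0 by exists c0; split => /=.
have dc : {within K, continuous d}.
  by apply: continuous_subspaceT; exact: continuous_dist2.
have [p] := compact_EVT_min K0 Kc dc.
rewrite inE => -[Cp dp] pmin.
exists p => // c Cc; case: (leP (d c) (d c0)) => [le|/ltW le].
  by apply: pmin; rewrite inE.
exact: le_trans dp le.
Qed.

(** If the angle at the nearest point [p] were acute, moving from [p] slightly towards [c] would
    stay in [C] and come closer to [w]. *)
Lemma projection_variational C w : closed C -> C !=set0 ->
  (forall a b t, C a -> C b -> (0 <= t <= 1)%R ->
    C ((1 - t) *: a + t *: b)%R) ->
  exists2 p, C p & forall c, C c -> (dotp (w - p) (c - p) <= 0)%R.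
Proof.
move=> Ccl C0 Cconv; have [p Cp pmin] := projection_exists w Ccl C0.
exists p => // c Cc; rewrite leNgt; apply/negP => gt0.
set m := dotp _ _ in gt0; pose D := dotp (c - p)%R (c - p)%R.
have D0 : (0 <= D)%R by exact: dotp_ge0.
(* The squared distance changes by [t * (t * D - 2 * m)]. This [t] lies in (0, 1] and satisfies
   [t * D <= m], so the change is negative. *)
pose t := (m / (m + D))%R.
have t0 : (0 < t)%R by rewrite divr_gt0 // ltr_wpDr.
have tE : (t * (m + D) = m)%R by rewrite divfK // gt_eqF // ltr_wpDr.
have t1 : (t <= 1)%R by rewrite ler_pdivrMr ?ltr_wpDr // mul1r lerDl.
have := pmin _ (Cconv p c t Cp Cc _); rewrite (ltW t0) t1 => /(_ isT).
have -> : ((1 - t) *: p + t *: c - w = t *: (c - p) - (w - p))%R.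
  by apply/rowP => i; rewrite !mxE; ring.
rewrite -(opprB w p) -/m; move: @m @D gt0 @t t0 tE t1 D0.
move: (w - p)%R (c - p)%R => e q m D gt0 t t0 tE t1 D0.
rewrite !(dotpDl, dotpDr, dotpNl, dotpNr, dotpZl, dotpZr) (dotpC q e) -/m -/D.
by nra.
Qed.
End Projection.

Lemma dotp_row_mx (R : realType) m n (a c : 'rV[R]_m) (b d : 'rV[R]_n) :
  dotp (row_mx a b) (row_mx c d) = (dotp a c + dotp b d)%R.
Proof. by rewrite /dotp tr_row_mx mul_row_col mxE. Qed.

(** * Affine minorants of a closed proper convex function, from its epigraph *)

Section AffineMinorant.
Variables (R : realType) (n : nat) (g : 'rV[R]_n -> \bar R).
Hypotheses (g_proper : proper_efun g) (g_lsc : lower_semicontinuous g)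
  (g_convex : convex_efun g).

Let epi : set 'rV[R]_(1 + n) :=
  [set w | g (rsubmx w) <= (lsubmx w 0 0)%R%:E].

(** Below the graph, some level [a] lies strictly between the height and the value of [g]; lower
    semicontinuity keeps [g] above [a] nearby, so the complement is open. *)
Let closed_epi : closed epi.
Proof.
rewrite -openC openE => w /= /negP; rewrite -ltNge => lt_wg.
have [a lwa lag] : exists2 a, (lsubmx w 0 0 < a)%R & a%:E < g (rsubmx w).
  move: lt_wg; case: (g _) => [r| |] //=.
    rewrite lte_fin => lr; exists ((lsubmx w 0 0 + r) / 2)%R.
      by rewrite midf_lt.
    by rewrite lte_fin midf_lt.
  by exists (lsubmx w 0 0 + 1)%R; rewrite ?ltry// ltrDl.
have [U nU Ug] := g_lsc lag.
have nw : nbhs w (rsubmx @^-1` U) by exact: (@continuous_rsubmx R 1 1 n w).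
have nl : nbhs w [set v | (lsubmx v 0 0 < a)%R].
  have : nbhs (lsubmx w) [set v : 'rV[R]_1 | (v 0 0 < a)%R].
    have cc := @coord_continuous R 1 1 ord0 ord0 (lsubmx w).
    by apply: (cc [set r | (r < a)%R]); exact: lt_nbhsl.
  exact: (@continuous_lsubmx R 1 1 n w).
rewrite /interior; apply: filterS (filterI nw nl) => v [/= Uv lva].
apply/negP; rewrite -ltNge; apply: lt_trans (Ug _ Uv).
by rewrite lte_fin.
Qed.

Let convex_epi a b (t : R) : epi a -> epi b -> (0 <= t <= 1)%R ->
  epi ((1 - t) *: a + t *: b)%R.
Proof.
rewrite /epi /= => ga gb t01; rewrite !linearD !linearZ /=.
apply: le_trans (g_convex _ _ t01) _.
move: ga gb; rewrite !mxE => ga gb; rewrite [leRHS]EFinD !EFinM.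
by case/andP: t01 => t0 t1; apply: leeD;
  apply: lee_wpmul2l => //; rewrite lee_fin ?subr_ge0.
Qed.

(** Here [(r, p)] is the projection of [(t, y)] onto [epi], whose first coordinate is the height,
    and the inequality is the variational one written by blocks. *)
Lemma epi_projection y (t : R) : exists p r, g p <= r%:E /\
  forall x q, g x <= q%:E ->
    (dotp (y - p) (x - p) + (t - r) * (q - r) <= 0)%R.
Proof.
have [gNy [x0 gx0]] := g_proper.
have [m gm] : exists m, g x0 <= m%:E.
  by move: gx0 (gNy x0); case: (g x0) => // r _ _; exists r.
have epi0 : epi !=set0.
  exists (row_mx (const_mx m) x0).
  by rewrite /epi /= row_mxKr row_mxKl mxE.
have [w Ew Hw] :=
  projection_variational (row_mx (const_mx t) y) closed_epi epi0 convex_epi.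
exists (rsubmx w), (lsubmx w 0 0)%R; split=> // x q gxq.
have := Hw (row_mx (const_mx q) x).
rewrite /epi /= row_mxKr row_mxKl mxE => /(_ gxq).
rewrite -{1 2}(hsubmxK w) !opp_row_mx !add_row_mx dotp_row_mx.
by rewrite (dotpE (_ - lsubmx w)%R) big_ord1 !mxE [leLHS]addrC.
Qed.

(** The epigraph is closed upwards, so the inequality can be tested at the point one unit above the
    projection. *)
Let slope_ge0 y (t : R) p r : g p <= r%:E ->
  (forall x q, g x <= q%:E ->
    (dotp (y - p) (x - p) + (t - r) * (q - r) <= 0)%R) ->
  (t <= r)%R.
Proof.
move=> gpr /(_ p (r + 1)%R); rewrite subrr {1}/dotp trmx0 mulmx0 mxE.
have -> : g p <= (r + 1)%:E by apply: le_trans gpr _; rewrite lee_fin lerDl.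
by move=> /(_ isT); lra.
Qed.

(** The separating hyperplane is not vertical: dividing by [r - t] solves the inequality for [q] and
    bounds [g] below by an affine function whose value at [y] is at least [r]. *)
Let affine_minorant_nonvertical y (t : R) p r : (t < r)%R ->
  (forall x q, g x <= q%:E ->
    (dotp (y - p) (x - p) + (t - r) * (q - r) <= 0)%R) ->
  exists d c, (forall x, (dotp d x - c)%:E <= g x) /\ (t < dotp d y - c)%R.
Proof.
move=> tr H; have [gNy _] := g_proper.
pose e := (r - t)%R; have e0 : (0 < e)%R by rewrite subr_gt0.
exists (e^-1 *: (y - p))%R, (e^-1 * dotp (y - p) p - r)%R; split=> [x|].
  move: (H x) (gNy x); case: (g x) => [q| |] // Hq _; last by rewrite leey.
  have {}Hq := Hq q (lexx _).
  rewrite lee_fin dotpZl opprB addrA addrAC -mulrBr.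
  have -> : (dotp (y - p) x - dotp (y - p) p = dotp (y - p) (x - p))%R.
    by rewrite dotpDr dotpNr.
  rewrite -lerBrDr ler_pdivrMl // /e; lra.
rewrite dotpZl opprB addrA addrAC -mulrBr.
have -> : (dotp (y - p) y - dotp (y - p) p = dotp (y - p) (y - p))%R.
  by rewrite -dotpNr -dotpDr.
apply: lt_le_trans tr _; rewrite lerDr mulr_ge0 ?dotp_ge0 //.
by rewrite invr_ge0 ltW.
Qed.

(** Project a point one unit below the graph at some [x0] of finite value. A vertical hyperplane
    would force [p = x0], hence the absurd [g x0 <= m - 1]. *)
Lemma affine_minorant_exists : exists d c, forall x, (dotp d x - c)%:E <= g x.
Proof.
have [gNy [x0 gx0]] := g_proper.
have [m gm] : exists m, g x0 = m%:E.
  by move: gx0 (gNy x0); case: (g x0) => // r _ _; exists r.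
have [p [r [gpr H]]] := epi_projection x0 (m - 1).
have := slope_ge0 gpr H; rewrite le_eqVlt => /predU1P[tr|tr]; last first.
  by have [d [c [? _]]] := affine_minorant_nonvertical tr H; exists d, c.
have := H x0 m; rewrite gm lexx => /(_ isT).
rewrite tr subrr mul0r addr0 => le0.
have xp : (x0 - p = 0)%R.
  by apply: dotp_eq0; apply/eqP; rewrite eq_le le0 dotp_ge0.
by move: gpr; rewrite -tr -(subr0_eq xp) gm lee_fin; lra.
Qed.

Lemma affine_minorant_approx y (t : R) : t%:E < g y ->
  exists d c, (forall x, (dotp d x - c)%:E <= g x) /\ (t < dotp d y - c)%R.
Proof.
move=> tg; have [gNy _] := g_proper.
have [p [r [gpr H]]] := epi_projection y t.
have := slope_ge0 gpr H; rewrite le_eqVlt => /predU1P[tr|tr]; last first.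
  exact: affine_minorant_nonvertical tr H.
(* The separating hyperplane is vertical: tilt a nonvertical minorant by it. *)
have [d0 [c0 H0]] := affine_minorant_exists.
set D := dotp (y - p)%R (y - p)%R.
have D0 : (0 < D)%R.
  rewrite lt_neqAle dotp_ge0 andbT; apply/eqP => /esym/dotp_eq0/subr0_eq yp.
  by move: tg; rewrite yp tr ltNge gpr.
(* The tilt adds [M * D] at [y]. The quotient covers the shortfall of the minorant below [t], and
   the extra 1 makes the inequality strict since [D] is positive. *)
pose M := (`|t - (dotp d0 y - c0)| / D + 1)%R.
exists (d0 + M *: (y - p))%R, (c0 + M * dotp (y - p) p)%R.
have expand x : (dotp (d0 + M *: (y - p)) x - (c0 + M * dotp (y - p) p) =
    dotp d0 x - c0 + M * dotp (y - p) (x - p))%R.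
  by rewrite dotpDl dotpZl (dotpDr (y - p)%R) dotpNr; ring.
have M0 : (0 <= M)%R by rewrite addr_ge0 // divr_ge0 // ltW.
split=> [x|]; rewrite expand.
  move: (H0 x) (H x) (gNy x); case: (g x) => [q| |] // H0x Hx _.
    have := Hx q (lexx _); rewrite tr subrr mul0r addr0 => le0.
    move: H0x; rewrite !lee_fin => H0x.
    by rewrite -[leRHS]addr0 lerD // mulr_ge0_le0.
  by rewrite leey.
have ME : (M * D = `|t - (dotp d0 y - c0)| + D)%R.
  by rewrite mulrDl mul1r divfK // gt_eqF.
rewrite -/D ME; have := ler_norm (t - (dotp d0 y - c0)); lra.
Qed.

End AffineMinorant.

Import VectorInternalTheory.

(** * Conjugates and the Fenchel-Young equality *)

Section Conjugate.
Variables (R : realType) (V : vectType R).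
Implicit Types (f : V -> \bar R) (y : V) (v : 'Hom(V, R^o)).

Lemma fenchel_young f v y : (v y)%:E - f y <= conjugate f v.
Proof. by apply: ereal_sup_ubound; exists y. Qed.

Lemma conjugate_gtNy f v : proper_efun f -> -oo < conjugate f v.
Proof.
move=> [fNy [y fy]]; apply: lt_le_trans (fenchel_young f v y).
by move: fy (fNy y); case: (f y) => // r _ _; rewrite ltNyr.
Qed.

(** Turns an affine minorant of slope [v] into a bound on the conjugate, which is how the epigraph
    argument reaches [conjugate f]. *)
Lemma conjugate_le f v c :
  (forall y, (v y - c)%:E <= f y) -> conjugate f v <= c%:E.
Proof.
move=> H; apply: ge_ereal_sup => _ [y _ <-]; rewrite /pairing.
move: (H y); case: (f y) => [r| |] //=; rewrite ?leNye //.
by rewrite -EFinB !lee_fin; lra.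
Qed.

Let dotp_v2r (d : 'rV[R]_(dim V)) y : R^o := dotp d (v2r y).

Let linear_dotp_v2r d : linear_for *:%R (dotp_v2r d).
Proof. by move=> t a b; rewrite /dotp_v2r linearP dotpDr dotpZr. Qed.

Let dotp_form (d : 'rV[R]_(dim V)) :
  exists v : 'Hom(V, R^o), forall y, v y = dotp d (v2r y).
Proof.
pose L : {linear V -> R^o} := HB.pack (dotp_v2r d)
  (GRing.isLinear.Build R V R^o *:%R (dotp_v2r d) (linear_dotp_v2r d)).
by exists (linfun L) => y; rewrite lfunE.
Qed.

Section Closed.
Variable f : V -> \bar R.
Hypotheses (f_proper : proper_efun f) (f_closed : closed_efun f)
  (f_convex : convex_efun f).

Let g (r : 'rV[R]_(dim V)) : \bar R := f (r2v r).

Let g_proper : proper_efun g.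
Proof.
have [fNy [y fy]] := f_proper; split=> [r|]; first exact: fNy.
by exists (v2r y); rewrite /g v2rK.
Qed.

Let g_convex : convex_efun g.
Proof. by move=> a b t t01; rewrite /g linearD !linearZ; exact: f_convex. Qed.

Let form_of_minorant d c : (forall r, (dotp d r - c)%:E <= g r) ->
  exists2 v : 'Hom(V, R^o), conjugate f v <= c%:E &
    forall y, v y = dotp d (v2r y).
Proof.
move=> H; have [v vE] := dotp_form d; exists v => //.
apply: conjugate_le => y; rewrite vE; apply: le_trans (H (v2r y)) _.
by rewrite /g v2rK.
Qed.

Lemma conjugate_lty : exists v, conjugate f v < +oo.
Proof.
have [d [c H]] := affine_minorant_exists g_proper f_closed g_convex.
have [v vc _] := form_of_minorant H.
by exists v; apply: le_lt_trans vc _; rewrite ltry.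
Qed.

(** This is the hard inequality of Fenchel-Moreau, that [f] lies below its biconjugate, phrased
    through approximating slopes. *)
Lemma biconjugate_approx y (t : R) : t%:E < f y ->
  exists v c, conjugate f v <= c%:E /\ (t < v y - c)%R.
Proof.
rewrite -{1}(v2rK y) => tf.
have [d [c [H td]]] := affine_minorant_approx g_proper f_closed g_convex tf.
have [v vc vE] := form_of_minorant H.
by exists v, c; rewrite vE.
Qed.

(* [subdiff] only compares the values [v y - f^* v]; that the best one is [f y]
   is the Fenchel-Moreau theorem. *)
Lemma subdiff_fenchel_young y v : subdiff f y v ->
  conjugate f v \is a fin_num /\ f y = (v y)%:E - conjugate f v.
Proof.
rewrite /subdiff /argmax /pairing /= => vmax.
have fin : conjugate f v \is a fin_num.
  rewrite fin_numElt conjugate_gtNy //=.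
  (* An infinite [conjugate f v] would give the maximizer [v] the value -oo, beaten by any [w] with
     finite conjugate. *)
  have [w wy] := conjugate_lty.
  move: (vmax w) (conjugate_gtNy w f_proper) wy.
  by case: (conjugate f w) => // c; case: (conjugate f v) => [?| |] //=;
    rewrite ?ltry.
split=> //; move: fin vmax (fenchel_young f v y).
case fvE : (conjugate f v) => [c| |] // _ vmax fy; rewrite -EFinB.
apply/eqP; rewrite eq_le; apply/andP; split.
  rewrite leNgt; apply/negP => /biconjugate_approx[w [c' [wc' lt]]].
  have := vmax w; apply/negP; rewrite -ltNge.
  move: wc' (conjugate_gtNy w f_proper); case: (conjugate f w) => // c''.
  by rewrite -!EFinB !(lte_fin, lee_fin) => ? _; lra.
move: fy (f_proper.1 y); case: (f y) => [r| |] //; last by rewrite leey.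
by rewrite -EFinB !lee_fin => ? _; lra.
Qed.

End Closed.

(** A maximizer attains the supremum defining the conjugate; comparison with a point where [f] is
    finite excludes an infinite [f y]. *)
Lemma subdiff_conjugate_fenchel_young f v y : proper_efun f ->
  subdiff_conjugate f v y ->
  f y \is a fin_num /\ conjugate f v = (v y)%:E - f y.
Proof.
rewrite /subdiff_conjugate /argmax /pairing /= => -[fNy [y0 fy0]] ymax.
split; last first.
  apply/eqP; rewrite eq_le fenchel_young andbT.
  by apply: ge_ereal_sup => _ [y' _ <-]; exact: ymax.
move: (ymax y0) fy0 (fNy y0) (fNy y).
by case: (f y0) => // c; case: (f y) => [?| |] //=.
Qed.

(** The conjugate is a supremum of functions affine in [v]. *)
Lemma convex_conjugate f : proper_efun f -> convex_efun (conjugate f).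
Proof.
move=> [fNy _] v v' t /andP[t0 t1].
apply: ge_ereal_sup => _ [y _ <-]; rewrite /pairing.
case fyE : (f y) (fNy y) => [r| |] // _; last by rewrite /= leNye.
have -> : (((1 - t) *: v + t *: v')%R y)%:E - r%:E =
    (1 - t)%:E * ((v y)%:E - f y) + t%:E * ((v' y)%:E - f y).
  rewrite fyE -!EFinB -!EFinM -EFinD add_lfunE !scale_lfunE /GRing.scale /=.
  by congr EFin; ring.
by apply: leeD; apply: lee_wpmul2l; rewrite ?lee_fin ?subr_ge0 //;
  exact: fenchel_young.
Qed.

(** The alternative [t = 1] covers the first step of the algorithm, where the value at the starting
    point may be infinite and is multiplied by zero. *)
Lemma convex_fin_num f y y' (t : R) : (forall y, f y != -oo) ->
  convex_efun f -> (0 <= t <= 1)%R -> (t = 1%R \/ f y \is a fin_num) ->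
  f y' \is a fin_num -> f ((1 - t) *: y + t *: y')%R \is a fin_num.
Proof.
move=> fNy fc t01 fy fy'; rewrite fin_numE fNy /= -ltey.
apply: le_lt_trans (fc _ _ _ t01) _.
rewrite -(fineK fy') -EFinM; case: fy => [->|/fineK<-].
  by rewrite subrr mul0e add0e ltry.
by rewrite -EFinM -EFinD ltry.
Qed.

End Conjugate.

(** * Linearity of the adjoint and the gap recurrence along the iterates *)

Lemma adjointD (R : realType) (X Y : vectType R) (A : 'Hom(X, Y)) u v :
  adjoint A (u + v)%R = (adjoint A u + adjoint A v)%R.
Proof. by apply/lfunP => x; rewrite /adjoint !(comp_lfunE, add_lfunE). Qed.

Lemma adjointZ (R : realType) (X Y : vectType R) (A : 'Hom(X, Y)) t u :
  adjoint A (t *: u)%R = (t *: adjoint A u)%R.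
Proof. by apply/lfunP => x; rewrite /adjoint !(comp_lfunE, scale_lfunE). Qed.

Lemma adjointN (R : realType) (X Y : vectType R) (A : 'Hom(X, Y)) u :
  adjoint A (- u)%R = (- adjoint A u)%R.
Proof. by rewrite -scaleN1r adjointZ scaleN1r. Qed.

(** Each step multiplies the old weights and the old gap by the same factor [1 - alpha k], and
    [alpha 0 = 1] erases [gap 0]. *)
Lemma weighted_sum_recurrence (R : realType) (alpha gap incr : nat -> R) :
  alpha 0%N = 1%R ->
  (forall k, gap k.+1 = (1 - alpha k) * gap k + incr k)%R ->
  forall k, (\sum_(0 <= i < k.+1) weight alpha k.+1 i * incr i = gap k.+1)%R.
Proof.
move=> alpha0 gapS; elim=> [|k IH].
  by rewrite big_nat1 /= mul1r gapS alpha0 subrr mul0r add0r.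
rewrite big_nat_recr //= eqxx mul1r gapS -IH mulr_sumr; congr (_ + _)%R.
by apply: eq_big_nat => i /andP[_ /ltn_eqF->]; rewrite mulrA.
Qed.

Theorem proposition5 (R : realType) (X Y : vectType R) (A : 'Hom(X, Y))
  (f : Y -> \bar R) (h : X -> \bar R)
  (f_proper : proper_efun f) (f_closed : closed_efun f) (f_convex : convex_efun f)
  (h_proper : proper_efun h) (h_closed : closed_efun h) (h_convex : convex_efun h)
  (df : Y -> 'Hom(Y, R^o)) (dhs : 'Hom(X, R^o) -> X)
  (df_oracle : forall y, dom_subdiff f y -> subdiff f y (df y))
  (dhs_oracle : forall u, dom_subdiff_conjugate h u ->
     subdiff_conjugate h u (dhs u))
  (df_range : forall y, dom_subdiff f y ->
     dom_subdiff_conjugate h (- adjoint A (df y))%R)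
  (dhs_range : forall u, dom_subdiff_conjugate h u ->
     dom_subdiff f (A (dhs u)))
  (alpha : nat -> R) (alpha01 : forall k, (0 <= alpha k <= 1)%R)
  (x s : nat -> X) (u z : nat -> 'Hom(Y, R^o))
  (algo : primal_dual_hybrid A df dhs alpha x s u z)
  (x_dom : forall k, dom_subdiff f (A (x k)))
  (u_dom : forall k, dom_subdiff_conjugate h (- adjoint A (u k))%R)
  (alpha0 : alpha 0%N = 1%R) :
  forall k : nat, (1 <= k)%N ->
    f (A (x k)) + h (x k) + conjugate f (u k)
      + conjugate h (- adjoint A (u k))%R =
    \sum_(0 <= i < k) (weight alpha k i)%:E *
      (calD (bregman_comp A f df) h (x i) (s i) (alpha i)
       + calD (bregman_conjugate_comp A h dhs) (conjugate (reflect_fun f))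
           (- u i)%R (- z i)%R (alpha i)).
Proof.
have hNy x' : h x' != -oo by case: h_proper.
have fsNy v : conjugate f v != -oo.
  by rewrite -ltNye conjugate_gtNy.
have algoP k : [/\ s k = dhs (- adjoint A (u k))%R, z k = df (A (x k)),
    x k.+1 = ((1 - alpha k) *: x k + alpha k *: s k)%R
  & u k.+1 = ((1 - alpha k) *: u k + alpha k *: z k)%R] := algo k.
have fy_f k : conjugate f (z k) \is a fin_num /\
    f (A (x k)) = (z k (A (x k)))%:E - conjugate f (z k).
  have [_ -> _ _] := algoP k; apply: subdiff_fenchel_young => //.
  exact: df_oracle.
have fy_h k : h (s k) \is a fin_num /\
    conjugate h (- adjoint A (u k))%R =
    ((- adjoint A (u k))%R (s k))%:E - h (s k).
  have [-> _ _ _] := algoP k; apply: subdiff_conjugate_fenchel_young => //.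
  exact: dhs_oracle.
have fin_hx k : h (x k.+1) \is a fin_num.
  have step j : alpha j = 1%R \/ h (x j) \is a fin_num ->
      h (x j.+1) \is a fin_num.
    have [_ _ -> _] := algoP j => xj; apply: convex_fin_num => //.
    by case: (fy_h j).
  by elim: k => [|k IH]; apply: step; [left|right].
have fin_fu k : conjugate f (u k.+1) \is a fin_num.
  have step j : alpha j = 1%R \/ conjugate f (u j) \is a fin_num ->
      conjugate f (u j.+1) \is a fin_num.
    have [_ _ _ ->] := algoP j => uj; apply: convex_fin_num => //.
      exact: convex_conjugate.
    by case: (fy_f j).
  by elim: k => [|k IH]; apply: step; [left|right].
(* Only h (x_0) and f^* (u_0) may be infinite; their coefficient is zero. *)
have scaled_fin (c : R) k e : (k = 0%N -> c = 0%R) ->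
    (forall j, k = j.+1 -> e \is a fin_num) ->
    c%:E * e = (c * fine e)%:E.
  by case: k => [-> // _|k _ /(_ k erefl)/fineK<-]; rewrite ?mul0e ?mul0r.
have fin_f k : f (A (x k)) \is a fin_num.
  by have [fz ->] := fy_f k; rewrite -(fineK fz).
have fin_hs k : conjugate h (- adjoint A (u k))%R \is a fin_num.
  by have [hs ->] := fy_h k; rewrite -(fineK hs).
(* [fine] sends an infinite value to 0, so [gap 0] need not be the true gap; it enters only with
   coefficient [1 - alpha 0 = 0]. With [incr] defined as the remainder of the recurrence, the
   content lies in [incrE]. *)
pose gap k := (fine (f (A (x k))) + fine (h (x k)) + fine (conjugate f (u k))
  + fine (conjugate h (- adjoint A (u k))%R))%R.
pose incr k := (gap k.+1 - (1 - alpha k) * gap k)%R.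
have incrE k : calD (bregman_comp A f df) h (x k) (s k) (alpha k)
    + calD (bregman_conjugate_comp A h dhs) (conjugate (reflect_fun f))
           (- u k)%R (- z k)%R (alpha k) = (incr k)%:E.
  rewrite /calD /bregman_comp /bregman_conjugate_comp /bregman
    /bregman_conjugate /pairing.
  have [sE zE xE uE] := algoP k.
  have uE' : ((1 - alpha k) *: - u k + alpha k *: - z k = - u k.+1)%R.
    by rewrite uE !scalerN opprD.
  rewrite uE' !conjugate_reflect !opprK !adjointN -sE -zE -xE.
  have alpha0' : k = 0%N -> (1 - alpha k = 0)%R.
    by move=> ->; rewrite alpha0 subrr.
  rewrite (@scaled_fin _ k (h (x k))) //; last by move=> j ->.
  rewrite (@scaled_fin _ k (conjugate f (u k))) //; last by move=> j ->.
  have dualE : ((- adjoint A (u k.+1) - - adjoint A (u k))%R (s k) =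
      - (alpha k * (z k (A (s k)) - u k (A (s k)))))%R.
    rewrite uE adjointD !adjointZ.
    rewrite !(add_lfunE, opp_lfunE, scale_lfunE, comp_lfunE) /GRing.scale /=.
    by ring.
  have primalE : (z k (A (x k.+1) - A (x k)) =
      alpha k * (z k (A (s k)) - z k (A (x k))))%R.
    rewrite xE !(linearD, linearB, linearZ) /= /GRing.scale /=; ring.
  have [fz fE] := fy_f k; have [hs hE] := fy_h k.
  have fR : fine (f (A (x k))) = (z k (A (x k)) - fine (conjugate f (z k)))%R.
    by rewrite fE -(fineK fz).
  have hR : fine (conjugate h (- adjoint A (u k))%R) =
      (- u k (A (s k)) - fine (h (s k)))%R.
    by rewrite hE -(fineK hs) opp_lfunE comp_lfunE.
  (* Every remaining extended value is finite, so the identity descends to the reals, where [fR] and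
     [hR] supply the two Fenchel-Young equalities. *)
  rewrite dualE primalE -(fineK (fin_f k.+1)) -(fineK (fin_f k)).
  rewrite -(fineK (fin_hx k)) -(fineK hs) -(fineK (fin_hs k.+1)).
  rewrite -(fineK (fin_hs k)) -(fineK (fin_fu k)) -(fineK fz).
  rewrite -!EFinM -!(EFinB, EFinD) -?EFinB -?EFinD; congr EFin.
  rewrite /incr /gap; move: fR hR => -> ->; ring.
move=> [//|k] _; under eq_bigr do rewrite incrE -EFinM.
rewrite sumEFin (@weighted_sum_recurrence _ _ gap) //; last first.
  by move=> j; rewrite /incr addrC subrK.
by rewrite /gap !EFinD !fineK.
Qed.
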